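(* Assume the standing setting and the approximation setting of the context, with the stability conditions (S1), (S2) and (S-seq) and the consistency conditions (C1), (C2). Then the sequential splitting with spatial approximation is convergent at every time level $t>0$: for every $x\in X$, $$\lim_{n,m\to\infty}J_m[S_m(t/n)T_m(t/n)]^nP_mx=U(t)x,$$ i.e. for every $\varepsilon>0$ there is $N$ such that $\|J_m[S_m(t/n)T_m(t/n)]^nP_mx-U(t)x\|\le\varepsilon$ for all $n,m\ge N$.
   Context: Standing setting: $X$ is a Banach space; $A$, $B$ are closed densely defined operators generating strongly continuous semigroups $(T(t))_{t\ge0}$, $(S(t))_{t\ge0}$ on $X$; the closure $\overline{A+B}$ satisfies $D(A)\cap D(B)\subset D(\overline{A+B})$ and generates a strongly continuous semigroup $(U(t))_{t\ge0}$. Approximation setting: $X_m$ ($m\in\mathbb{N}$) are Banach spaces, $P_m:X\to X_m$, $J_m:X_m\to X$ bounded linear operators with $P_mJ_m=I_m$, $J_mP_mx\to x$ for all $x\in X$, and $\|J_m\|\le M_J$, $\|P_m\|\le M_P$ for all $m$. Operators $A_m$, $B_m$ generate strongly continuous semigroups $(T_m(t))_{t\ge0}$, $(S_m(t))_{t\ge0}$ on $X_m$. Stability: (S1) there are $M_T\ge1$, $\omega_T$ with $\|T(h)\|,\|T_m(h)\|\le M_Te^{\omega_Th}$ for all $h>0$, $m$; (S2) there are $M_S\ge1$, $\omega_S$ with $\|S(h)\|,\|S_m(h)\|\le M_Se^{\omega_Sh}$ for all $h>0$, $m$; (S-seq) there are $M\ge1$, $\omega\in\mathbb{R}$ with $\|[S_m(t/n)T_m(t/n)]^k\|\le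 Me^{k\omega t/n}$ for all $t\ge0$, $k,n,m\in\mathbb{N}$. Consistency: (C1) $J_mA_mP_mx\to Ax$ for all $x\in D(A)$; (C2) $J_mB_mP_mx\to Bx$ for all $x\in D(B)$. *)

(* Defs.v *)
From Stdlib Require Import Reals.
Open Scope R_scope.

Record Banach := {
  car :> Type;
  vzero : car;
  vadd : car -> car -> car;
  vopp : car -> car;
  vscal : R -> car -> car;
  vnorm : car -> R;
  vadd_assoc : forall x y z, vadd x (vadd y z) = vadd (vadd x y) z;
  vadd_comm : forall x y, vadd x y = vadd y x;
  vadd_0 : forall x, vadd vzero x = x;
  vadd_opp : forall x, vadd x (vopp x) = vzero;
  vscal_addv : forall a x y, vscal a (vadd x y) = vadd (vscal a x) (vscal a y);
  vscal_adds : forall a b x, vscal (a + b) x = vadd (vscal a x) (vscal b x);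
  vscal_mul : forall a b x, vscal a (vscal b x) = vscal (a * b) x;
  vscal_1 : forall x, vscal 1 x = x;
  vnorm_nonneg : forall x, 0 <= vnorm x;
  vnorm_eq0 : forall x, vnorm x = 0 -> x = vzero;
  vnorm_scal : forall a x, vnorm (vscal a x) = Rabs a * vnorm x;
  vnorm_triangle : forall x y, vnorm (vadd x y) <= vnorm x + vnorm y;
  vcomplete : forall u : nat -> car,
    (forall eps, 0 < eps -> exists N, forall p q, (N <= p)%nat -> (N <= q)%nat ->
        vnorm (vadd (u p) (vopp (u q))) < eps) ->
    exists l, forall eps, 0 < eps -> exists N, forall n, (N <= n)%nat ->
        vnorm (vadd (u n) (vopp l)) < eps
}.

Arguments vzero {_}. Arguments vadd {_}. Arguments vopp {_}.
Arguments vscal {_}. Arguments vnorm {_}.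

Definition vsub {X : Banach} (x y : X) : X := vadd x (vopp y).

Definition seq_lim {X : Banach} (u : nat -> X) (l : X) : Prop :=
  forall eps, 0 < eps -> exists N, forall n, (N <= n)%nat -> vnorm (vsub (u n) l) < eps.

Definition lim_0plus {X : Banach} (f : R -> X) (l : X) : Prop :=
  forall eps, 0 < eps -> exists delta, 0 < delta /\
    forall h, 0 < h < delta -> vnorm (vsub (f h) l) < eps.

Definition linear_map {X Y : Banach} (f : X -> Y) : Prop :=
  (forall x y, f (vadd x y) = vadd (f x) (f y)) /\
  (forall a x, f (vscal a x) = vscal a (f x)).

Definition bounded_linear {X Y : Banach} (f : X -> Y) : Prop :=
  linear_map f /\ exists c, forall x, vnorm (f x) <= c * vnorm x.

Definition opnorm_le {X Y : Banach} (f : X -> Y) (c : R) : Prop :=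
  forall x, vnorm (f x) <= c * vnorm x.

(** (Possibly unbounded) operators: a domain and an action
    (the action is only meaningful on the domain). *)
Record Op (X : Banach) := { dom : X -> Prop; app : X -> X }.
Arguments dom {_}. Arguments app {_}.

Definition linear_op {X : Banach} (A : Op X) : Prop :=
  dom A vzero /\
  (forall x y, dom A x -> dom A y -> dom A (vadd x y) /\
      app A (vadd x y) = vadd (app A x) (app A y)) /\
  (forall a x, dom A x -> dom A (vscal a x) /\ app A (vscal a x) = vscal a (app A x)).

Definition closed_op {X : Banach} (A : Op X) : Prop :=
  forall (u : nat -> X) x y, (forall n, dom A (u n)) ->
    seq_lim u x -> seq_lim (fun n => app A (u n)) y -> dom A x /\ app A x = y.

Definition densely_defined {X : Banach} (A : Op X) : Prop :=
  forall x eps, 0 < eps -> exists y, dom A y /\ vnorm (vsub x y) < eps.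

Definition op_sum {X : Banach} (A B : Op X) : Op X :=
  {| dom := fun x => dom A x /\ dom B x; app := fun x => vadd (app A x) (app B x) |}.

Definition is_closure {X : Banach} (A C : Op X) : Prop :=
  forall x y, (dom C x /\ app C x = y) <->
    (forall eps, 0 < eps -> exists z, dom A z /\ vnorm (vsub z x) < eps /\
        vnorm (vsub (app A z) y) < eps).

Definition C0_semigroup {X : Banach} (T : R -> X -> X) : Prop :=
  (forall t, 0 <= t -> bounded_linear (T t)) /\
  (forall x, T 0 x = x) /\
  (forall t s x, 0 <= t -> 0 <= s -> T (t + s) x = T t (T s x)) /\
  (forall t x, 0 <= t -> forall eps, 0 < eps -> exists delta, 0 < delta /\
      forall s, 0 <= s -> Rabs (s - t) < delta -> vnorm (vsub (T s x) (T t x)) < eps).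

Definition is_generator {X : Banach} (A : Op X) (T : R -> X -> X) : Prop :=
  forall x, (dom A x <-> exists y, lim_0plus (fun h => vscal (/ h) (vsub (T h x) x)) y) /\
            (dom A x -> lim_0plus (fun h => vscal (/ h) (vsub (T h x) x)) (app A x)).

Definition generates {X : Banach} (A : Op X) (T : R -> X -> X) : Prop :=
  C0_semigroup T /\ is_generator A T.

(* Main.v *)
(** For [x] in the domain of [C], the curve [s |-> U s x] need not stay in the common
    domain of [A] and [B], so it cannot be inserted into the usual telescoping sum.
    Since [C] is the closure of [A + B], the points [U (j t / N) x] can however be replaced
    by points [z j] of the common domain, close in the graph norm to within [o(t / N)].
    Their polygon solves [v' = (A + B) v] up to an arbitrarily small error, and lives in the
    convex hull of finitely many vectors of the common domain, so that the scheme
    [S_m(h) T_m(h)] is consistent uniformly along it. Stability then sums the local errors.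
    The scheme takes [q = n / N] (integer quotient) steps on each edge of the polygon, and
    the remaining [n mod N] steps are negligible. Local consistency, uniform in [m], rests
    on a mean value inequality for orbits and on the equicontinuity at [0] of the
    [T_m(h) P_m f], obtained from the density of the domains. *)

Require Import Defs.
From Stdlib Require Import Reals Lra Lia ClassicalEpsilon.
From Stdlib Require Import FunctionalExtensionality PropExtensionality.
From Coquelicot Require Import Coquelicot.
Open Scope list_scope.
Open Scope R_scope.

(** * Vector arithmetic *)

Section VectorArithmetic.
Context {X : Banach}.
Implicit Types x y z : X.

Lemma vadd_0r x : vadd x vzero = x.
Proof. rewrite vadd_comm; apply vadd_0. Qed.

Lemma vadd_cancel x y z : vadd x y = vadd x z -> y = z.
Proof.
  intros H.
  rewrite <- (vadd_0 X y), <- (vadd_0 X z), <- (vadd_opp X x), (vadd_comm X x).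
  now rewrite <- !vadd_assoc, H.
Qed.

Lemma vscal_0l x : vscal 0 x = vzero.
Proof.
  apply (vadd_cancel (vscal 0 x)).
  now rewrite <- vscal_adds, vadd_0r, Rplus_0_l.
Qed.

Lemma vscal_0r a : vscal a (@vzero X) = vzero.
Proof.
  apply (vadd_cancel (vscal a vzero)).
  now rewrite <- vscal_addv, !vadd_0r.
Qed.

Lemma vopp_scal x : vopp x = vscal (-1) x.
Proof.
  apply (vadd_cancel x). rewrite vadd_opp.
  rewrite <- (vscal_1 X x) at 1. rewrite <- vscal_adds.
  replace (1 + -1) with 0 by ring. now rewrite vscal_0l.
Qed.

(** * Linear identities between vectors by reflection *)

Inductive vexpr :=
  | VZero | VAtom (n : nat) | VAdd (e f : vexpr) | VOpp (e : vexpr)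
  | VScal (a : R) (e : vexpr).

Fixpoint veval (env : list X) (e : vexpr) : X :=
  match e with
  | VZero => vzero
  | VAtom n => List.nth n env vzero
  | VAdd e f => vadd (veval env e) (veval env f)
  | VOpp e => vopp (veval env e)
  | VScal a e => vscal a (veval env e)
  end.

Fixpoint vcoef (e : vexpr) (i : nat) : R :=
  match e with
  | VZero => 0
  | VAtom n => if Nat.eqb n i then 1 else 0
  | VAdd e f => vcoef e i + vcoef f i
  | VOpp e => - vcoef e i
  | VScal a e => a * vcoef e i
  end.

Fixpoint vlin (c : nat -> R) (env : list X) (i : nat) : X :=
  match env with
  | nil => vzero
  | x :: l => vadd (vscal (c i) x) (vlin c l (S i))
  end.

(** Recursion on [env], rather than a quantifier over indices, lets this reduce to a finite
    conjunction of real equations, one per atom, fit for [ring] and [field]. *)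
Fixpoint vcoef_eq (c d : nat -> R) (env : list X) (i : nat) : Prop :=
  match env with
  | nil => True
  | _ :: l => c i = d i /\ vcoef_eq c d l (S i)
  end.

Lemma vadd_swap x y z t :
  vadd (vadd x y) (vadd z t) = vadd (vadd x z) (vadd y t).
Proof.
  rewrite <- !vadd_assoc; f_equal.
  now rewrite !vadd_assoc, (vadd_comm X y z).
Qed.

Lemma vlin_ext c d env i : vcoef_eq c d env i -> vlin c env i = vlin d env i.
Proof.
  revert i; induction env as [|x l IH]; intros i; simpl; auto.
  intros [-> H]; now rewrite IH.
Qed.

Lemma vlin_add c d env i :
  vlin (fun j => c j + d j) env i = vadd (vlin c env i) (vlin d env i).
Proof.
  revert i; induction env as [|x l IH]; intros i; simpl.
  - now rewrite vadd_0.
  - now rewrite IH, vscal_adds, vadd_swap.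
Qed.

Lemma vlin_scal a c env i :
  vlin (fun j => a * c j) env i = vscal a (vlin c env i).
Proof.
  revert i; induction env as [|x l IH]; intros i; simpl.
  - now rewrite vscal_0r.
  - now rewrite IH, vscal_addv, vscal_mul.
Qed.

Lemma vlin_opp c env i :
  vlin (fun j => - c j) env i = vopp (vlin c env i).
Proof.
  rewrite vopp_scal, <- vlin_scal. apply vlin_ext.
  generalize i; induction env as [|x l IH]; intros k; simpl; auto.
  split; auto. ring.
Qed.

Lemma vlin_zero env i : vlin (fun _ => 0) env i = vzero.
Proof.
  revert i; induction env as [|x l IH]; intros i; simpl; auto.
  now rewrite IH, vscal_0l, vadd_0.
Qed.

Lemma vlin_atom n env i :
  vlin (fun j => if Nat.eqb (i + n) j then 1 else 0) env i = List.nth n env vzero.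
Proof.
  revert i n; induction env as [|x l IH]; intros i n; simpl.
  - now destruct n.
  - destruct n as [|n].
    + rewrite Nat.add_0_r, Nat.eqb_refl, vscal_1.
      transitivity (vadd x vzero); [f_equal | apply vadd_0r].
      rewrite <- (vlin_zero l (S i)). apply vlin_ext.
      assert (H : forall k, (i < k)%nat ->
        vcoef_eq (fun j => if Nat.eqb i j then 1 else 0) (fun _ => 0) l k).
      { clear. induction l as [|y l IH]; intros k Hk; simpl; auto.
        split; [|apply IH; lia].
        destruct (Nat.eqb_spec i k); [lia | auto]. }
      apply H; lia.
    + destruct (Nat.eqb_spec (i + S n) i); [lia|].
      rewrite vscal_0l, vadd_0, <- (IH (S i) n).
      now replace (S i + n)%nat with (i + S n)%nat by lia.
Qed.

Lemma veval_vlin env e : veval env e = vlin (vcoef e) env 0.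
Proof.
  induction e; simpl.
  - symmetry; apply vlin_zero.
  - symmetry; apply (vlin_atom n env 0).
  - now rewrite vlin_add, IHe1, IHe2.
  - now rewrite vlin_opp, IHe.
  - now rewrite vlin_scal, IHe.
Qed.

Lemma veval_eq env e f :
  vcoef_eq (vcoef e) (vcoef f) env 0 -> veval env e = veval env f.
Proof. intros H; rewrite !veval_vlin; now apply vlin_ext. Qed.

End VectorArithmetic.

Ltac vindex x env :=
  lazymatch env with
  | x :: _ => constr:(0%nat)
  | _ :: ?l => let n := vindex x l in constr:(S n)
  end.

Ltac vatoms e env :=
  lazymatch e with
  | vzero => env
  | vadd ?a ?b => let env := vatoms a env in vatoms b env
  | vsub ?a ?b => let env := vatoms a env in vatoms b env
  | vopp ?a => vatoms a env
  | vscal _ ?a => vatoms a env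
  | _ => match env with
         (* [vindex] fails when [e] is not yet listed; the backtracking [match] then adds it as a
            new atom. *)
         | _ => let _ := vindex e env in env
         | _ => constr:(e :: env)
         end
  end.

Ltac vreify e env :=
  lazymatch e with
  | vzero => constr:(VZero)
  | vadd ?a ?b => let a := vreify a env in let b := vreify b env in constr:(VAdd a b)
  | vsub ?a ?b => let a := vreify a env in let b := vreify b env in constr:(VAdd a (VOpp b))
  | vopp ?a => let a := vreify a env in constr:(VOpp a)
  | vscal ?r ?a => let a := vreify a env in constr:(VScal r a)
  | _ => let n := vindex e env in constr:(VAtom n)
  end.

(* Decides linear identities between vectors by comparing the coefficients of each atom. *)
Ltac vec :=
  lazymatch goal with
  | |- @eq (car ?Y) ?a ?b =>
    let env := vatoms a (@nil (car Y)) in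
    let env := vatoms b env in
    let e := vreify a env in
    let f := vreify b env in
    change (veval env e = veval env f); apply veval_eq;
    cbv [vcoef_eq vcoef Nat.eqb]; repeat split; try ring; try (field; repeat split; auto; lra)
  end.

(** * Norm estimates and linear maps *)

Lemma vnorm_0 (X : Banach) : vnorm (@vzero X) = 0.
Proof. rewrite <- (vscal_0l vzero), vnorm_scal, Rabs_R0; ring. Qed.

Lemma vnorm_opp (X : Banach) (x : X) : vnorm (vopp x) = vnorm x.
Proof. rewrite vopp_scal, vnorm_scal, Rabs_left; lra. Qed.

Lemma vnorm_sub_sym (X : Banach) (x y : X) : vnorm (vsub x y) = vnorm (vsub y x).
Proof. rewrite <- vnorm_opp; f_equal; vec. Qed.

Lemma vnorm_scal_pos (X : Banach) a (x : X) : 0 <= a -> vnorm (vscal a x) = a * vnorm x.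
Proof. intros; rewrite vnorm_scal, Rabs_pos_eq; auto. Qed.

Lemma vnorm_le2 (X : Banach) (x a b : X) ea eb :
  x = vadd a b -> vnorm a <= ea -> vnorm b <= eb -> vnorm x <= ea + eb.
Proof. intros -> ? ?; pose proof (vnorm_triangle X a b); lra. Qed.

Lemma vnorm_le3 (X : Banach) (x a b c : X) ea eb ec :
  x = vadd (vadd a b) c -> vnorm a <= ea -> vnorm b <= eb -> vnorm c <= ec ->
  vnorm x <= ea + eb + ec.
Proof. intros -> ? ? ?. eapply vnorm_le2; [reflexivity| |assumption]. now eapply vnorm_le2. Qed.

Section LinearMaps.
Context {X Y : Banach} {f : X -> Y} (hf : linear_map f).

Lemma linear_map_sub x y : f (vsub x y) = vsub (f x) (f y).
Proof.
  unfold vsub. rewrite (proj1 hf), (vopp_scal y), (proj2 hf). now rewrite <- vopp_scal.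
Qed.

Lemma linear_map_0 : f vzero = vzero.
Proof. rewrite <- (vscal_0l vzero), (proj2 hf); apply vscal_0l. Qed.

End LinearMaps.

Lemma opnorm_le_weaken (X Y : Banach) (f : X -> Y) c d :
  opnorm_le f c -> c <= d -> opnorm_le f d.
Proof. intros H Hcd x; specialize (H x); pose proof (vnorm_nonneg X x); nra. Qed.

Lemma bounded_linear_opnorm (X Y : Banach) (f : X -> Y) :
  bounded_linear f -> exists c, 0 < c /\ opnorm_le f c.
Proof.
  intros [_ [c H]]. exists (Rmax c 1); split.
  - pose proof (Rmax_r c 1); lra.
  - eapply opnorm_le_weaken; [exact H | apply Rmax_l].
Qed.

(** If [b < a], an [e] with [c * e < a - b] gives a contradiction; dividing by [c + 1] covers
    [c = 0]. *)
Lemma Rle_eps_mult a b c : 0 <= c -> (forall e, 0 < e -> a <= b + c * e) -> a <= b.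
Proof.
  intros Hc H. apply Rnot_lt_le; intros Hab.
  assert (He : 0 < (a - b) / (c + 1) / 2) by (repeat apply Rdiv_lt_0_compat; lra).
  specialize (H _ He).
  assert (c * ((a - b) / (c + 1) / 2) < a - b); [|lra].
  replace (c * ((a - b) / (c + 1) / 2)) with ((a - b) * (c / (c + 1) / 2)) by (field; lra).
  assert (c / (c + 1) < 1) by (apply Rmult_lt_reg_r with (c + 1); [lra|]; field_simplify; lra).
  nra.
Qed.

(** * Orbits of a semigroup *)

(** Right-hand growth is enough. With slack [eps], let [c] be the supremum of the points up to which
    the bound holds. Continuity gives the bound at [c], and if [c < h] the growth condition at [c]
    carries it beyond [c]. *)
Lemma mean_value_inequality (X : Banach) (f : R -> X) (h L : R) :
  0 <= h ->
  (forall s, 0 <= s <= h -> forall eps, 0 < eps -> exists delta, 0 < delta /\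
     forall r, 0 <= r <= h -> Rabs (r - s) < delta -> vnorm (vsub (f r) (f s)) < eps) ->
  (forall s, 0 <= s < h -> forall eps, 0 < eps -> exists delta, 0 < delta /\
     forall k, 0 < k < delta -> vnorm (vsub (f (s + k)) (f s)) <= (L + eps) * k) ->
  vnorm (vsub (f h) (f 0)) <= L * h.
Proof.
  intros Hh Hcont Hder.
  apply Rle_eps_mult with h; auto. intros eps Heps.
  set (good := fun s => 0 <= s <= h /\
    forall r, 0 <= r <= s -> vnorm (vsub (f r) (f 0)) <= (L + eps) * r).
  assert (good0 : good 0).
  { split; [lra|]. intros r Hr. replace r with 0 by lra.
    replace (vsub (f 0) (f 0)) with (@vzero X) by vec. rewrite vnorm_0; lra. }
  destruct (completeness good) as [c [Hub Hlub]].
  { exists h; intros s [Hs _]; lra. }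
  { now exists 0. }
  assert (Hc0 : 0 <= c) by now apply Hub.
  assert (Hch : c <= h) by (apply Hlub; intros s [Hs _]; lra).
  assert (Hbelow : forall r, 0 <= r < c -> vnorm (vsub (f r) (f 0)) <= (L + eps) * r).
  { intros r Hr. apply NNPP; intros Hn.
    assert (c <= r); [|lra]. apply Hlub. intros s [Hs Hs'].
    apply Rnot_lt_le; intros Hrs. apply Hn, Hs'; lra. }
  assert (Hc : vnorm (vsub (f c) (f 0)) <= (L + eps) * c).
  { destruct (Req_dec c 0) as [->|Hcn]; [apply good0; lra|].
    (* [L + eps] may be negative, so passing from a nearby [r < c] to [c] can cost
       [Rabs (L + eps) * (c - r)]. *)
    apply Rle_eps_mult with (1 + Rabs (L + eps)); [pose proof (Rabs_pos (L + eps)); lra|].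
    intros e He. destruct (Hcont c (conj Hc0 Hch) e He) as [d [Hd Hd']].
    set (r := Rmax 0 (c - Rmin d e / 2)).
    assert (0 < Rmin d e) by now apply Rmin_glb_lt.
    pose proof (Rmin_l d e); pose proof (Rmin_r d e).
    assert (Hr : 0 <= r < c /\ c - Rmin d e / 2 <= r).
    { unfold r, Rmax. destruct (Rle_dec 0 (c - Rmin d e / 2)); lra. }
    assert (Hfr := Hbelow r (proj1 Hr)).
    assert (Hfc := Hd' r ltac:(lra) ltac:(rewrite Rabs_left; lra)).
    rewrite vnorm_sub_sym in Hfc.
    assert (vnorm (vsub (f c) (f 0)) <= e + (L + eps) * r).
    { eapply vnorm_le2; [|apply Rlt_le, Hfc|exact Hfr]; vec. }
    pose proof (Rle_abs (- (L + eps))) as Ha. rewrite Rabs_Ropp in Ha.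
    assert (- (L + eps) * (c - r) <= Rabs (L + eps) * e).
    { apply Rle_trans with (Rabs (L + eps) * (c - r)).
      - apply Rmult_le_compat_r; lra.
      - apply Rmult_le_compat_l; [apply Rabs_pos|lra]. }
    nra. }
  destruct (Rlt_le_dec c h) as [Hlt|Hge].
  - exfalso. destruct (Hder c (conj Hc0 Hlt) eps Heps) as [d [Hd Hd']].
    set (k := Rmin (d / 2) (h - c)).
    assert (Hk : 0 < k < d /\ k <= h - c).
    { unfold k; split; [split|]; [apply Rmin_glb_lt; lra| |apply Rmin_r].
      pose proof (Rmin_l (d / 2) (h - c)); lra. }
    assert (c + k <= c); [|lra]. apply Hub. split; [lra|]. intros r Hr.
    destruct (Rlt_le_dec r c) as [Hrc|Hcr]; [apply Hbelow; lra|].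
    destruct (Req_dec r c) as [->|Hn]; [auto|].
    replace ((L + eps) * r) with ((L + eps) * (r - c) + (L + eps) * c) by ring.
    eapply vnorm_le2; [| |exact Hc]; [|apply Hd'; lra].
    replace (c + (r - c)) with r by ring. vec.
  - replace h with c in * by lra. lra.
Qed.

Lemma lim_0plus_unique (X : Banach) (f : R -> X) l l' :
  lim_0plus f l -> lim_0plus f l' -> l = l'.
Proof.
  intros H H'.
  assert (E : vsub l l' = vzero).
  { apply vnorm_eq0, Rle_antisym; [|apply vnorm_nonneg].
    apply Rle_eps_mult with 2; [lra|]. intros e He.
    destruct (H e He) as [d [Hd Hl]], (H' e He) as [d' [Hd' Hl']].
    set (k := Rmin d d' / 2).
    assert (0 < Rmin d d') by now apply Rmin_glb_lt.
    pose proof (Rmin_l d d'); pose proof (Rmin_r d d').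
    specialize (Hl k ltac:(unfold k; lra)). specialize (Hl' k ltac:(unfold k; lra)).
    rewrite vnorm_sub_sym in Hl.
    replace (0 + 2 * e) with (e + e) by ring.
    eapply vnorm_le2; [|apply Rlt_le, Hl|apply Rlt_le, Hl']. vec. }
  replace l with (vadd l' (vsub l l')) by vec. now rewrite E, vadd_0r.
Qed.

Section Orbits.
Context {X : Banach} {A : Op X} {T : R -> X -> X} (hT : generates A T).

Lemma sg_linear t : 0 <= t -> linear_map (T t).
Proof. intros Ht; apply (proj1 (proj1 hT) t Ht). Qed.

Lemma sg_0 x : T 0 x = x.
Proof. apply hT. Qed.

Lemma sg_add t s x : 0 <= t -> 0 <= s -> T (t + s) x = T t (T s x).
Proof. apply hT. Qed.

Lemma sg_orbit_right_diff x s : dom A x -> 0 <= s ->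
  lim_0plus (fun k => vscal (/ k) (vsub (T (s + k) x) (T s x))) (T s (app A x)).
Proof.
  intros Hx Hs eps Heps.
  destruct (bounded_linear_opnorm _ _ _ (proj1 (proj1 hT) s Hs)) as [c [Hc Hb]].
  destruct (proj2 (proj2 hT x) Hx (eps / c) (Rdiv_lt_0_compat _ _ Heps Hc)) as [d [Hd H]].
  exists d; split; auto. intros k Hk. specialize (H k Hk).
  rewrite sg_add by lra.
  rewrite <- (linear_map_sub (sg_linear s Hs)), <- (proj2 (sg_linear s Hs)).
  rewrite <- (linear_map_sub (sg_linear s Hs)).
  eapply Rle_lt_trans; [apply Hb|].
  replace eps with (c * (eps / c)) by (field; lra).
  now apply Rmult_lt_compat_l.
Qed.

(** [T (s + k) x] is also [T k (T s x)], so the right difference quotient of the orbit at [s] is the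
    quotient at [0] that defines the generator at [T s x]. *)
Lemma dom_sg x s : dom A x -> 0 <= s -> dom A (T s x) /\ app A (T s x) = T s (app A x).
Proof.
  intros Hx Hs.
  assert (H : lim_0plus (fun k => vscal (/ k) (vsub (T k (T s x)) (T s x))) (T s (app A x))).
  { intros eps Heps. destruct (sg_orbit_right_diff x s Hx Hs eps Heps) as [d [Hd H]].
    exists d; split; auto. intros k Hk.
    rewrite <- sg_add, Rplus_comm by lra. now apply H. }
  assert (D : dom A (T s x)) by (apply (proj2 hT (T s x)); eauto).
  split; auto. eapply lim_0plus_unique; [|exact H]. now apply (proj2 hT (T s x)).
Qed.

(** Mean value inequality for [T s x - s a], whose right derivative is [T s (app A x) - a]. The
    vector [a] is free: zero gives a Lipschitz bound, an approximation of [app A x] gives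
    consistency. *)
Lemma sg_increment x a h L : dom A x -> 0 <= h ->
  (forall s, 0 <= s <= h -> vnorm (vsub (T s (app A x)) a) <= L) ->
  vnorm (vsub (vsub (T h x) x) (vscal h a)) <= L * h.
Proof.
  intros Hx Hh HL.
  replace (vsub (vsub (T h x) x) (vscal h a))
    with (vsub (vsub (T h x) (vscal h a)) (vsub (T 0 x) (vscal 0 a))) by (rewrite sg_0; vec).
  apply (mean_value_inequality X (fun s => vsub (T s x) (vscal s a))); auto.
  - intros s Hs eps Heps.
    destruct (proj2 (proj2 (proj2 (proj1 hT))) s x (proj1 Hs) (eps / 2) ltac:(lra))
      as [d [Hd H]].
    pose proof (vnorm_nonneg X a) as Ha.
    set (d' := eps / 2 / (vnorm a + 1)).
    assert (Hd' : 0 < d') by (apply Rdiv_lt_0_compat; lra).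
    exists (Rmin d d'); split; [now apply Rmin_glb_lt|].
    intros r Hr Hrs.
    pose proof (Rmin_l d d'); pose proof (Rmin_r d d').
    assert (Hr1 := H r (proj1 Hr) ltac:(lra)).
    assert (Hr2 : vnorm (vscal (s - r) a) <= eps / 2).
    { rewrite vnorm_scal, Rabs_minus_sym.
      replace (eps / 2) with (d' * (vnorm a + 1)) by (unfold d'; field; lra).
      apply Rmult_le_compat; [apply Rabs_pos|lra|lra|lra]. }
    replace (vsub (vsub (T r x) (vscal r a)) (vsub (T s x) (vscal s a)))
      with (vadd (vsub (T r x) (T s x)) (vscal (s - r) a)) by vec.
    pose proof (vnorm_triangle X (vsub (T r x) (T s x)) (vscal (s - r) a)). lra.
  - intros s Hs eps Heps.
    destruct (sg_orbit_right_diff x s Hx (proj1 Hs) eps Heps) as [d [Hd H]].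
    exists d; split; auto. intros k Hk. specialize (H k Hk).
    replace (vsub (vsub (T (s + k) x) (vscal (s + k) a)) (vsub (T s x) (vscal s a)))
      with (vscal k (vadd (vsub (T s (app A x)) a)
        (vsub (vscal (/ k) (vsub (T (s + k) x) (T s x))) (T s (app A x))))) by vec.
    rewrite vnorm_scal_pos, Rmult_comm by lra. apply Rmult_le_compat_r; [lra|].
    eapply vnorm_le2; [reflexivity|apply HL; lra|lra].
Qed.

(** Compactness of [[0, t]]. Continuity is used on twice the covering radius, so that both [s] and
    its neighbour [r], which may exceed [t], stay in the range of the same centre. *)
Lemma sg_orbit_unif_cont x t eps : 0 < eps -> exists delta, 0 < delta /\
  forall s r, 0 <= s <= t -> 0 <= r -> Rabs (r - s) < delta ->
    vnorm (vsub (T r x) (T s x)) < eps.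
Proof.
  intros Heps.
  assert (H : forall s, exists d : posreal, 0 <= s ->
    forall r, 0 <= r -> Rabs (r - s) < 2 * d -> vnorm (vsub (T r x) (T s x)) < eps / 2).
  { intros s. destruct (Rle_dec 0 s) as [Hs|Hs].
    - destruct (proj2 (proj2 (proj2 (proj1 hT))) s x Hs (eps / 2) ltac:(lra)) as [d [Hd H]].
      assert (Hd2 : 0 < d / 2) by lra.
      exists (mkposreal _ Hd2); intros _ r Hr Hrs. apply H; auto. simpl in Hrs; lra.
    (* Default radius at negative points, where the requirement is vacuous. *)
    - exists (mkposreal 1 Rlt_0_1); intros; lra. }
  set (delta := fun s => proj1_sig (constructive_indefinite_description _ (H s))).
  destruct (compactness_value_1d 0 t delta) as [d Hd].
  exists d; split; [apply cond_pos|]. intros s r Hs Hr Hrs.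
  apply NNPP; intros Hn. apply (Hd s Hs). intros [u [Hu [Hsu Hdu]]]. apply Hn.
  unfold delta in *. destruct (constructive_indefinite_description _ (H u)) as [e He].
  simpl in *. assert (Hpos := cond_pos e).
  assert (Hs' := He (proj1 Hu) s (proj1 Hs) ltac:(lra)).
  assert (Hru : Rabs (r - u) < 2 * e).
  { replace (r - u) with ((r - s) + (s - u)) by ring.
    pose proof (Rabs_triang (r - s) (s - u)); lra. }
  assert (Hr' := He (proj1 Hu) r Hr Hru).
  rewrite vnorm_sub_sym in Hs'.
  replace (vsub (T r x) (T s x))
    with (vadd (vsub (T r x) (T u x)) (vsub (T u x) (T s x))) by vec.
  pose proof (vnorm_triangle X (vsub (T r x) (T u x)) (vsub (T u x) (T s x))). lra.
Qed.

End Orbits.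

(** * Density of the domain of a generator *)

Section CoquelicotStructure.
Context (X : Banach).

Definition banach_AbelianMonoid_mixin := AbelianMonoid.Mixin (car X) vadd vzero
  (vadd_comm X) (vadd_assoc X) vadd_0r.

Definition banach_AbelianGroup_mixin :=
  AbelianGroup.Mixin (AbelianMonoid.Pack _ banach_AbelianMonoid_mixin (car X)) vopp (vadd_opp X).

Definition banach_AbelianGroup_class :=
  AbelianGroup.Class _ banach_AbelianMonoid_mixin banach_AbelianGroup_mixin.

Definition banach_ModuleSpace_mixin :=
  ModuleSpace.Mixin R_Ring (AbelianGroup.Pack _ banach_AbelianGroup_class (car X)) vscal
    (vscal_mul X) (vscal_1 X) (vscal_addv X) (vscal_adds X).

Definition banach_ball (x : X) (e : R) (y : X) := vnorm (vsub y x) < e.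

Lemma banach_ball_center x (e : posreal) : banach_ball x e x.
Proof.
  unfold banach_ball. replace (vsub x x) with (@vzero X) by vec.
  rewrite vnorm_0; apply cond_pos.
Qed.

Lemma banach_ball_sym x y e : banach_ball x e y -> banach_ball y e x.
Proof. unfold banach_ball; now rewrite vnorm_sub_sym. Qed.

Lemma banach_ball_triangle x y z e1 e2 :
  banach_ball x e1 y -> banach_ball y e2 z -> banach_ball x (e1 + e2) z.
Proof.
  unfold banach_ball; intros H1 H2.
  replace (vsub z x) with (vadd (vsub y x) (vsub z y)) by vec.
  pose proof (vnorm_triangle X (vsub y x) (vsub z y)); lra.
Qed.

Definition banach_UniformSpace_mixin := UniformSpace.Mixin (car X) vzero
  banach_ball banach_ball_center banach_ball_sym banach_ball_triangle.

Definition banach_NormedModuleAux_class := NormedModuleAux.Class R_AbsRing (car X)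
  (ModuleSpace.Class R_Ring _ _ banach_ModuleSpace_mixin) banach_UniformSpace_mixin.

Lemma banach_norm_scal (a : R) (x : X) : vnorm (vscal a x) <= Rabs a * vnorm x.
Proof. rewrite vnorm_scal; apply Rle_refl. Qed.

Lemma banach_ball_norm (x y : X) (eps : posreal) :
  banach_ball x eps y -> vnorm (vsub y x) < 1 * eps.
Proof. now rewrite Rmult_1_l. Qed.

Definition banach_NormedModule_mixin :=
  NormedModule.Mixin R_AbsRing
    (NormedModuleAux.Pack R_AbsRing _ banach_NormedModuleAux_class (car X))
    vnorm 1 (vnorm_triangle X) banach_norm_scal (fun _ _ _ h => h) banach_ball_norm
    (vnorm_eq0 X).

Definition banach_UniformSpace := UniformSpace.Pack (car X) banach_UniformSpace_mixin (car X).

(** Completeness is given for sequences only. Choose centres [u n] of balls of radius [1 / (n + 1)]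
    belonging to [F]; any two of these balls meet, so [u] is Cauchy, and its limit is a limit of
    [F]. *)
Lemma banach_cauchy_filter (F : (banach_UniformSpace -> Prop) -> Prop) :
  ProperFilter F -> cauchy F -> exists l : banach_UniformSpace,
    forall eps : posreal, F (ball l eps).
Proof.
  intros PF HF.
  assert (H : forall n, exists x : X, F (banach_ball x (/ (INR n + 1)))).
  { intros n. pose proof (pos_INR n).
    assert (Hn : 0 < / (INR n + 1)) by (apply Rinv_0_lt_compat; lra).
    apply (HF (mkposreal _ Hn)). }
  set (u := fun n => proj1_sig (constructive_indefinite_description _ (H n))).
  assert (Hu : forall n, F (banach_ball (u n) (/ (INR n + 1)))).
  { intros n; apply (proj2_sig (constructive_indefinite_description _ (H n))). }
  assert (small : forall eps, 0 < eps -> exists N, forall n, (N <= n)%nat ->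
    / (INR n + 1) < eps).
  { intros eps Heps. destruct (INR_unbounded (/ eps)) as [N HN]. exists N. intros n Hn.
    apply le_INR in Hn. assert (0 < / eps) by now apply Rinv_0_lt_compat.
    rewrite <- (Rinv_inv eps). apply Rinv_lt_contravar; [nra|lra]. }
  destruct (vcomplete X u) as [l Hl].
  { intros eps Heps. destruct (small (eps / 2) ltac:(lra)) as [N HN]. exists N.
    intros p q Hp Hq. apply HN in Hp, Hq.
    destruct (filter_ex (F := F) _ (filter_and _ _ (Hu p) (Hu q))) as [z [Hzp Hzq]].
    apply banach_ball_sym in Hzp.
    assert (Hpq := banach_ball_triangle _ _ _ _ _ Hzq Hzp).
    unfold banach_ball, vsub in Hpq. lra. }
  exists l. intros eps. assert (Heps := cond_pos eps).
  destruct (small (eps / 2) ltac:(lra)) as [N HN].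
  destruct (Hl (eps / 2) ltac:(lra)) as [N' HN'].
  set (n := Nat.max N N'). specialize (HN n ltac:(lia)). specialize (HN' n ltac:(lia)).
  generalize (Hu n). apply filter_imp. intros z Hz.
  assert (Hlz := banach_ball_triangle _ _ _ _ _ HN' Hz).
  change (vnorm (vsub z l) < eps). unfold banach_ball in Hlz. lra.
Qed.

(** A total function, as the structure demands; the value is arbitrary when [F] has no limit. *)
Definition banach_lim (F : (banach_UniformSpace -> Prop) -> Prop) : banach_UniformSpace :=
  epsilon (inhabits (vzero : X)) (fun l : banach_UniformSpace => forall eps : posreal, F (ball l eps)).

Lemma banach_lim_correct F : ProperFilter F -> cauchy F ->
  forall eps : posreal, F (ball (banach_lim F) eps).
Proof. intros PF HF. exact (epsilon_spec _ _ (banach_cauchy_filter F PF HF)). Qed.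

Lemma banach_lim_ext F1 F2 : filter_le F1 F2 -> filter_le F2 F1 ->
  close (banach_lim F1) (banach_lim F2).
Proof.
  intros H12 H21. replace F2 with F1; [intros eps; apply ball_center|].
  apply functional_extensionality; intros Q; apply propositional_extensionality; split; auto.
Qed.

Definition banach_CompleteSpace_mixin := CompleteSpace.Mixin banach_UniformSpace
  banach_lim banach_lim_correct banach_lim_ext.

Definition banach_CNM : CompleteNormedModule R_AbsRing :=
  CompleteNormedModule.Pack R_AbsRing (car X)
    (CompleteNormedModule.Class R_AbsRing (car X)
      (NormedModule.Class R_AbsRing _ _ banach_NormedModule_mixin)
      banach_CompleteSpace_mixin) (car X).

End CoquelicotStructure.

(** [L] commutes with Riemann sums, and its continuity passes to the limit. *)
Lemma is_RInt_linear_map (X : Banach) (L : X -> X) (f : R -> banach_CNM X) a b I :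
  bounded_linear L -> is_RInt f a b I ->
  is_RInt (fun s => L (f s) : banach_CNM X) a b (L I).
Proof.
  intros HL Hf.
  assert (Hlin := proj1 HL). destruct (bounded_linear_opnorm _ _ _ HL) as [c [Hc Hb]].
  assert (HR : forall ptd, Riemann_sum (fun s => L (f s) : banach_CNM X) ptd
                           = L (Riemann_sum f ptd)).
  { apply SF_cons_ind.
    - intros x0. symmetry. apply (linear_map_0 Hlin).
    - intros h s IH. rewrite !Riemann_sum_cons, IH.
      symmetry. etransitivity; [apply (proj1 Hlin)|].
      exact (f_equal (fun v => vadd v _) (proj2 Hlin _ _)). }
  unfold is_RInt in *.
  apply filterlim_ext
    with (fun ptd => L (scal (sign (b - a)) (Riemann_sum f ptd)) : banach_CNM X).
  { intros ptd; rewrite HR; exact (proj2 Hlin _ _). }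
  apply (filterlim_comp _ _ _ _ L _ _ _ Hf).
  apply (proj2 (filterlim_locally (U := banach_CNM X) (F := locally I) L (L I))). intros eps.
  assert (He : 0 < eps / c) by (apply Rdiv_lt_0_compat; [apply cond_pos|auto]).
  exists (mkposreal _ He). intros y Hy.
  change (vnorm (vsub (L y) (L I)) < eps). change (vnorm (vsub y I) < eps / c) in Hy.
  rewrite <- (linear_map_sub Hlin).
  eapply Rle_lt_trans; [apply Hb|].
  replace (pos eps) with (c * (eps / c)) by (field; lra). now apply Rmult_lt_compat_l.
Qed.

Lemma is_RInt_near_const (X : Banach) (f : R -> banach_CNM X) a h (I : banach_CNM X) (v : X) e :
  0 <= h -> is_RInt f a (a + h) I ->
  (forall s, a <= s <= a + h -> vnorm (vsub (f s) v) <= e) ->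
  vnorm (vsub I (vscal h v)) <= h * e.
Proof.
  intros Hh HI He.
  assert (H := norm_RInt_le_const (fun s => minus (f s) (v : banach_CNM X)) a (a + h) _ e
    ltac:(lra) He (is_RInt_minus _ _ _ _ _ _ HI (is_RInt_const a (a + h) (v : banach_CNM X)))).
  replace (a + h - a) with h in H by ring. exact H.
Qed.

(* The averages of the orbit of [x] over short intervals [[0, tau]] lie in the domain. *)
Lemma generator_dense (X : Banach) (A : Op X) (T : R -> X -> X) :
  generates A T -> densely_defined A.
Proof.
  intros hT x eps Heps.
  assert (Hcont : forall s, 0 <= s -> forall e, 0 < e -> exists d, 0 < d /\
    forall r, 0 <= r -> Rabs (r - s) < d -> vnorm (vsub (T r x) (T s x)) < e).
  { intros s Hs; now apply (proj1 hT). }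
  (* The even extension is continuous on the whole line, so integrals exist between any bounds. *)
  set (f := fun s => T (Rabs s) x : banach_CNM X).
  assert (Hf : forall a b, ex_RInt f a b).
  { intros a b. apply (ex_RInt_continuous (V := banach_CNM X)). intros s _.
    apply filterlim_locally. intros e.
    destruct (Hcont (Rabs s) (Rabs_pos s) e (cond_pos e)) as [d [Hd H]].
    exists (mkposreal d Hd). intros r Hr. apply H; [apply Rabs_pos|].
    eapply Rle_lt_trans; [apply Rabs_triang_inv2|exact Hr]. }
  assert (Hnear : forall a, 0 <= a -> forall e, 0 < e -> exists d, 0 < d /\
    forall h, 0 <= h < d ->
      vnorm (vsub (RInt f a (a + h) : X) (vscal h (T a x))) <= h * e).
  { intros a Ha e He. destruct (Hcont a Ha e He) as [d [Hd H]]. exists d; split; auto.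
    intros h Hh. eapply is_RInt_near_const; [lra|apply (RInt_correct (V := banach_CNM X)), Hf|].
    intros s Hs. unfold f. rewrite Rabs_pos_eq by lra.
    apply Rlt_le, H; [lra|]. rewrite Rabs_pos_eq; lra. }
  destruct (Hnear 0 (Rle_refl 0) (eps / 2) ltac:(lra)) as [d [Hd H0]].
  set (tau := d / 2). set (I := RInt f 0 tau : X).
  assert (Htau : 0 < tau < d) by (unfold tau; lra).
  (* [T h] translates the integral to [[h, tau + h]]; comparing with [[0, tau]] leaves only two
     integrals of length [h], at the two ends. *)
  assert (shift : forall h, 0 < h -> vsub (T h I) I =
    vsub (RInt f tau (tau + h) : X) (RInt f 0 (0 + h) : X)).
  { intros h Hh.
    assert (E : T h I = RInt f h (tau + h)).
    { symmetry. apply (is_RInt_unique (V := banach_CNM X)).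
      assert (H := is_RInt_linear_map X (T h) f 0 tau I (proj1 (proj1 hT) h ltac:(lra))
        (RInt_correct (V := banach_CNM X) _ _ _ (Hf 0 tau))).
      replace tau with (1 * (tau + h) + - h) in H by ring.
      replace 0 with (1 * h + - h) in H at 1 by ring.
      apply (is_RInt_comp_lin (V := banach_CNM X)) in H.
      eapply is_RInt_ext; [|exact H].
      intros s Hs. rewrite Rmin_left, Rmax_right in Hs by lra.
      change (vscal 1 (T h (T (Rabs (1 * s + - h)) x)) = T (Rabs s) x).
      rewrite vscal_1, !Rabs_pos_eq, <- (sg_add hT) by lra. f_equal; ring. }
    rewrite E, Rplus_0_l.
    assert (E1 : vadd (RInt f 0 h : X) (RInt f h (tau + h) : X) = RInt f 0 (tau + h))
      by exact (RInt_Chasles (V := banach_CNM X) f 0 h (tau + h) (Hf _ _) (Hf _ _)).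
    assert (E2 : vadd (RInt f 0 tau : X) (RInt f tau (tau + h) : X) = RInt f 0 (tau + h))
      by exact (RInt_Chasles (V := banach_CNM X) f 0 tau (tau + h) (Hf _ _) (Hf _ _)).
    unfold I. apply (vadd_cancel (vadd (RInt f 0 h : X) (RInt f 0 tau : X))).
    transitivity (vadd (RInt f 0 h : X) (RInt f h (tau + h) : X)); [vec|].
    rewrite E1, <- E2. vec. }
  assert (DI : dom A (vscal (/ tau) I)).
  { apply (proj2 hT). exists (vscal (/ tau) (vsub (T tau x) x)).
    (* The two end integrals each err by [h * e']; after division by [h * tau] the total is
       [2 * e / 3 < e]. *)
    intros e He. set (e' := e * tau / 3).
    assert (He' : 0 < e') by (unfold e'; nra).
    destruct (Hnear 0 (Rle_refl 0) e' He') as [d0 [Hd0 N0]].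
    destruct (Hnear tau ltac:(lra) e' He') as [d1 [Hd1 N1]].
    exists (Rmin d0 d1); split; [now apply Rmin_glb_lt|]. intros h Hh.
    pose proof (Rmin_l d0 d1); pose proof (Rmin_r d0 d1).
    specialize (N0 h ltac:(lra)). specialize (N1 h ltac:(lra)).
    rewrite (sg_0 hT), vnorm_sub_sym in N0.
    rewrite (proj2 (sg_linear hT h ltac:(lra))).
    replace (vsub (vscal (/ h) (vsub (vscal (/ tau) (T h I)) (vscal (/ tau) I)))
              (vscal (/ tau) (vsub (T tau x) x)))
      with (vscal (/ h * / tau) (vsub (vsub (T h I) I) (vscal h (vsub (T tau x) x))))
      by vec.
    rewrite shift by lra.
    rewrite vnorm_scal_pos by (apply Rlt_le, Rmult_lt_0_compat; apply Rinv_0_lt_compat; lra).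
    apply Rle_lt_trans with (/ h * / tau * (h * e' + h * e')).
    - apply Rmult_le_compat_l;
        [apply Rlt_le, Rmult_lt_0_compat; apply Rinv_0_lt_compat; lra|].
      eapply vnorm_le2; [|exact N1|exact N0]. vec.
    - unfold e'. replace (/ h * / tau * (h * (e * tau / 3) + h * (e * tau / 3)))
        with (2 * e / 3) by (field; lra). lra. }
  exists (vscal (/ tau) I); split; auto.
  specialize (H0 tau ltac:(lra)). rewrite Rplus_0_l, (sg_0 hT), vnorm_sub_sym in H0.
  change (RInt f 0 tau : X) with I in H0.
  replace (vsub x (vscal (/ tau) I)) with (vscal (/ tau) (vsub (vscal tau x) I)) by vec.
  rewrite vnorm_scal_pos by (apply Rlt_le, Rinv_0_lt_compat; lra).
  apply Rle_lt_trans with (/ tau * (tau * (eps / 2))).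
  - apply Rmult_le_compat_l; auto. apply Rlt_le, Rinv_0_lt_compat; lra.
  - replace (/ tau * (tau * (eps / 2))) with (eps / 2) by (field; lra). lra.
Qed.

(** * Consistency *)

Section ConsistencyOfOneFamily.
Context {X : Banach} {Xm : nat -> Banach}.
Context {P : forall m, X -> Xm m} {J : forall m, Xm m -> X} {cP : R}.
Context (hcP : 0 < cP) (hP : forall m, linear_map (P m)) (hPb : forall m, opnorm_le (P m) cP).
Context (hPJ : forall m (y : Xm m), P m (J m y) = y).
Context {A : Op X} {Am : forall m, Op (Xm m)} {Tm : forall m, R -> Xm m -> Xm m} {c : R}.
Context (hA : densely_defined A) (hTm : forall m, generates (Am m) (Tm m)).
Context (hc : 0 < c) (hTb : forall m s, 0 <= s <= 1 -> opnorm_le (Tm m s) c).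
Context (hC : forall x, dom A x -> (forall m, dom (Am m) (P m x)) /\
            seq_lim (fun m => J m (app (Am m) (P m x))) (app A x)).

(** [P m (J m y) = y] and the uniform bound on [P m] transfer the convergence from [X] to [Xm m],
    where the scheme acts. *)
Lemma generator_consistency z e : dom A z -> 0 < e -> exists m0, forall m, (m0 <= m)%nat ->
  vnorm (vsub (app (Am m) (P m z)) (P m (app A z))) <= e.
Proof.
  intros Hz He.
  destruct (proj2 (hC z Hz) (e / cP) (Rdiv_lt_0_compat _ _ He hcP)) as [m0 H].
  exists m0; intros m Hm. specialize (H m Hm).
  rewrite <- (hPJ m (app (Am m) (P m z))), <- (linear_map_sub (hP m)).
  eapply Rle_trans; [apply hPb|].
  replace e with (cP * (e / cP)) by (field; lra). apply Rmult_le_compat_l; lra.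
Qed.

(** Replace [f] by a nearby [g] in [dom A]: the orbit of [P m g] is Lipschitz near [0] with a
    constant independent of [m], and the uniform bound [c] controls the contribution of [f - g]. *)
Lemma sg_equicontinuous f e : 0 < e -> exists h0 m0, 0 < h0 <= 1 /\
  forall m h, (m0 <= m)%nat -> 0 <= h <= h0 ->
    vnorm (vsub (Tm m h (P m f)) (P m f)) <= e.
Proof.
  intros He.
  assert (Hpos : 0 < 2 * ((c + 1) * cP)) by (apply Rmult_lt_0_compat; nra).
  destruct (hA f (e / (2 * ((c + 1) * cP))) (Rdiv_lt_0_compat _ _ He Hpos)) as [g [Hg Hfg]].
  set (e1 := e / (2 * ((c + 1) * cP))) in *.
  destruct (generator_consistency g 1 Hg Rlt_0_1) as [m0 Hm0].
  (* A bound, for all [m >= m0], on the norm of [app (Am m) (P m g)]; the [1] is the consistency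
     error just allowed. *)
  set (b := 1 + cP * vnorm (app A g)).
  assert (Hb : 0 < b) by (pose proof (vnorm_nonneg X (app A g)); unfold b; nra).
  assert (Hcb : 0 < 2 * (c * b)) by (apply Rmult_lt_0_compat; nra).
  set (h0 := Rmin 1 (e / (2 * (c * b)))).
  assert (Hh0 : 0 < h0) by (apply Rmin_glb_lt; [lra|now apply Rdiv_lt_0_compat]).
  exists h0, m0; split; [split; [auto|apply Rmin_l]|].
  intros m h Hm Hh.
  assert (Hh1 : h <= 1) by (pose proof (Rmin_l 1 (e / (2 * (c * b)))); unfold h0 in *; lra).
  assert (Hh2 : h <= e / (2 * (c * b)))
    by (pose proof (Rmin_r 1 (e / (2 * (c * b)))); unfold h0 in *; lra).
  assert (HPfg : vnorm (P m (vsub f g)) <= cP * e1).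
  { eapply Rle_trans; [apply hPb|]. apply Rmult_le_compat_l; lra. }
  assert (HAg : vnorm (app (Am m) (P m g)) <= b).
  { specialize (Hm0 m Hm). unfold b. rewrite Rplus_comm.
    eapply vnorm_le2; [|apply (hPb m (app A g))|exact Hm0]. vec. }
  assert (Hincr : vnorm (vsub (vsub (Tm m h (P m g)) (P m g)) (vscal h vzero)) <= c * b * h).
  { apply (sg_increment (hTm m)); [apply (proj1 (hC g Hg))|lra|].
    intros s Hs. replace (vsub (Tm m s (app (Am m) (P m g))) vzero)
      with (Tm m s (app (Am m) (P m g))) by vec.
    eapply Rle_trans; [apply hTb; lra|]. apply Rmult_le_compat_l; lra. }
  apply Rle_trans with (c * (cP * e1) + cP * e1 + c * b * h).
  - eapply (vnorm_le3 _ _ (Tm m h (P m (vsub f g))) (vopp (P m (vsub f g)))); [| | |exact Hincr].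
    + rewrite (linear_map_sub (hP m)), (linear_map_sub (sg_linear (hTm m) h (proj1 Hh))). vec.
    + eapply Rle_trans; [apply hTb; lra|]. apply Rmult_le_compat_l; lra.
    + now rewrite vnorm_opp.
  - replace (c * (cP * e1) + cP * e1) with (e / 2) by (unfold e1; field; split; lra).
    assert (c * b * h <= e / 2); [|lra].
    apply Rle_trans with (c * b * (e / (2 * (c * b)))); [apply Rmult_le_compat_l; nra|].
    right; field; split; lra.
Qed.

(** By [sg_increment] it suffices that [Tm m s (app (Am m) (P m z))] stay close to [P m (app A z)].
    Generator consistency replaces the argument by [P m (app A z)], and equicontinuity then removes
    [Tm m s]. *)
Lemma sg_consistency z e : dom A z -> 0 < e -> exists h0 m0, 0 < h0 <= 1 /\
  forall m h, (m0 <= m)%nat -> 0 <= h <= h0 ->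
    vnorm (vsub (vsub (Tm m h (P m z)) (P m z)) (vscal h (P m (app A z)))) <= e * h.
Proof.
  intros Hz He.
  destruct (sg_equicontinuous (app A z) (e / 2) ltac:(lra)) as [h0 [m0 [Hh0 H]]].
  assert (Hec : 0 < e / 2 / c) by (apply Rdiv_lt_0_compat; lra).
  destruct (generator_consistency z (e / 2 / c) Hz Hec) as [m1 H1].
  exists h0, (Nat.max m0 m1); split; auto. intros m h Hm Hh.
  apply (sg_increment (hTm m)); [apply (proj1 (hC z Hz))|lra|].
  intros s Hs. replace e with (c * (e / 2 / c) + e / 2) by (field; lra).
  eapply (vnorm_le2 _ _ (Tm m s (vsub (app (Am m) (P m z)) (P m (app A z)))));
    [| |apply (H m s); [lia|lra]].
  - rewrite (linear_map_sub (sg_linear (hTm m) s (proj1 Hs))). vec.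
  - eapply Rle_trans; [apply hTb; lra|].
    apply Rmult_le_compat_l; [lra|]. apply H1; lia.
Qed.

End ConsistencyOfOneFamily.

(** * Stability *)

Lemma linear_map_iter (Y : Banach) (K : Y -> Y) i : linear_map K -> linear_map (Nat.iter i K).
Proof.
  intros HK; induction i as [|i IH].
  - split; auto.
  - change (linear_map (fun y => K (Nat.iter i K y))).
    split; intros; [rewrite (proj1 IH); apply HK | rewrite (proj2 IH); apply HK].
Qed.

(** Telescoping: [K^n v_0 - v_n] is the sum over [i < n] of [K^(n-1-i) (K v_i - v_(i+1))], so only
    powers below [n] must be bounded. *)
Lemma lax_telescope (Y : Banach) (K : Y -> Y) c e n (v : nat -> Y) : linear_map K ->
  (forall i, (i < n)%nat -> opnorm_le (Nat.iter i K) c) ->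
  (forall i, (i < n)%nat -> vnorm (vsub (K (v i)) (v (S i))) <= e) ->
  0 <= c -> vnorm (vsub (Nat.iter n K (v 0%nat)) (v n)) <= INR n * (c * e).
Proof.
  intros HK. revert v. induction n as [|n IH]; intros v Hc Hv c0.
  - simpl. replace (vsub (v 0%nat) (v 0%nat)) with (@vzero Y) by vec. rewrite vnorm_0; lra.
  - rewrite S_INR. replace ((INR n + 1) * (c * e)) with (c * e + INR n * (c * e)) by ring.
    rewrite Nat.iter_succ_r.
    eapply vnorm_le2 with (a := Nat.iter n K (vsub (K (v 0%nat)) (v 1%nat)))
                          (b := vsub (Nat.iter n K (v 1%nat)) (v (S n))).
    + rewrite (linear_map_sub (linear_map_iter _ _ n HK)). vec.
    + eapply Rle_trans; [apply Hc; lia|]. apply Rmult_le_compat_l; [auto|apply Hv; lia].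
    + apply (IH (fun i => v (S i))); [intros i Hi; apply Hc; lia|intros i Hi; apply Hv; lia|auto].
Qed.

Lemma iter_mul {Y : Type} (K : Y -> Y) p q y :
  Nat.iter (p * q) K y = Nat.iter p (Nat.iter q K) y.
Proof.
  induction p as [|p IH]; simpl; auto. now rewrite Nat.iter_add, IH.
Qed.

(* Along the segment from [z] to [z'], cut into [q] pieces, each application of [K] makes
   an error of order [h e], because [z'-z] is close to both [tau g] and [tau g']. *)
Lemma segment_error (X Y : Banach) (P : X -> Y) (K : Y -> Y) (z z' g g' : X) q c cP h tau e :
  linear_map P -> opnorm_le P cP -> linear_map K -> (1 <= q)%nat -> 0 < h -> 0 < tau ->
  0 <= c -> 0 <= cP ->
  (forall i, (i < q)%nat -> opnorm_le (Nat.iter i K) c) ->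
  vnorm (vsub (vsub (K (P z)) (P z)) (vscal h (P g))) <= e * h ->
  vnorm (vsub (vsub (K (P z')) (P z')) (vscal h (P g'))) <= e * h ->
  vnorm (vsub (vsub z' z) (vscal tau g)) <= e * tau ->
  vnorm (vsub (vsub z' z) (vscal tau g')) <= e * tau ->
  Rabs (h / tau - / INR q) * vnorm (vsub z' z) <= e * h ->
  vnorm (vsub (Nat.iter q K (P z)) (P z')) <= INR q * (c * ((1 + 2 * cP) * (e * h))).
Proof.
  intros HP HPb HK Hq Hh Htau Hc HcP HKb Hz Hz' Hg Hg' Hgap.
  assert (Hq0 : 0 < INR q) by (apply lt_0_INR; lia).
  set (th := fun i => INR i / INR q).
  set (v := fun i => P (vadd (vscal (1 - th i) z) (vscal (th i) z'))).
  assert (E0 : P z = v 0%nat).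
  { unfold v, th. f_equal. simpl. vec. }
  assert (E1 : P z' = v q).
  { unfold v, th. f_equal. vec. }
  rewrite E0, E1. apply lax_telescope; auto.
  intros i Hi.
  assert (Hth : 0 <= th i <= 1).
  { unfold th. pose proof (pos_INR i). apply lt_INR in Hi. split.
    - apply Rmult_le_pos; [lra|]. now apply Rlt_le, Rinv_0_lt_compat.
    - apply Rmult_le_reg_r with (INR q); [auto|]. field_simplify; lra. }
  (* Balls are convex, so bounds at the two endpoints pass to the points of the segment. *)
  assert (Hconv : forall (Z : Banach) (x y : Z) b, vnorm x <= b -> vnorm y <= b ->
    vnorm (vadd (vscal (1 - th i) x) (vscal (th i) y)) <= b).
  { intros Z x y b Hx Hy. replace b with ((1 - th i) * b + th i * b) by ring.
    eapply vnorm_le2; [reflexivity| |]; rewrite vnorm_scal_pos by lra;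
      apply Rmult_le_compat_l; lra. }
  replace ((1 + 2 * cP) * (e * h)) with (e * h + cP * (e * h) + cP * (e * h)) by ring.
  (* Three errors: consistency of [K] at the endpoints, the deviation of the edge from [tau] times
     the interpolated [g], and the mismatch between the step fraction [h / tau] and the grid
     fraction [1 / q]. *)
  eapply vnorm_le3 with
    (a := vadd (vscal (1 - th i) (vsub (vsub (K (P z)) (P z)) (vscal h (P g))))
               (vscal (th i) (vsub (vsub (K (P z')) (P z')) (vscal h (P g')))))
    (b := P (vscal (- (h / tau)) (vadd (vscal (1 - th i) (vsub (vsub z' z) (vscal tau g)))
                                       (vscal (th i) (vsub (vsub z' z) (vscal tau g'))))))
    (c := P (vscal (h / tau - / INR q) (vsub z' z))).
  - unfold v.
    assert (Hth' : th (S i) = th i + / INR q) by (unfold th; rewrite S_INR; field; lra).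
    rewrite Hth'.
    repeat (rewrite ?(proj1 HP), ?(proj2 HP), ?(linear_map_sub HP),
                    ?(proj1 HK), ?(proj2 HK)).
    vec.
  - now apply Hconv.
  - eapply Rle_trans; [apply HPb|]. apply Rmult_le_compat_l; auto.
    rewrite vnorm_scal, Rabs_Ropp, Rabs_pos_eq
      by (apply Rlt_le, Rdiv_lt_0_compat; lra).
    replace (e * h) with (h / tau * (e * tau)) by (field; lra).
    apply Rmult_le_compat_l; [apply Rlt_le, Rdiv_lt_0_compat; lra|].
    now apply Hconv.
  - eapply Rle_trans; [apply HPb|]. apply Rmult_le_compat_l; auto.
    now rewrite vnorm_scal.
Qed.

(** * Approximate trajectories in the domain of the sum *)

Lemma approximate_trajectory (X : Banach) (G C : Op X) (U : R -> X -> X) x t e :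
  is_closure G C -> generates C U -> dom C x -> 0 < t -> 0 < e ->
  exists (N : nat) (z : nat -> X), (1 <= N)%nat /\ (forall j, dom G (z j)) /\
    vnorm (vsub x (z 0%nat)) <= e /\ vnorm (vsub (z N) (U t x)) <= e /\
    forall j, (j < N)%nat -> let tau := t / INR N in
      vnorm (vsub (vsub (z (S j)) (z j)) (vscal tau (app G (z j)))) <= e * tau /\
      vnorm (vsub (vsub (z (S j)) (z j)) (vscal tau (app G (z (S j))))) <= e * tau.
Proof.
  intros HC HU Hx Ht He.
  destruct (sg_orbit_unif_cont HU (app C x) t (e / 2) ltac:(lra)) as [d [Hd Hunif]].
  destruct (INR_unbounded (Rmax 1 (t / d))) as [N HN].
  pose proof (Rmax_l 1 (t / d)); pose proof (Rmax_r 1 (t / d)).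
  assert (HN1 : (1 <= N)%nat) by (apply INR_le; simpl; lra).
  set (tau := t / INR N).
  assert (Htau : 0 < tau) by (apply Rdiv_lt_0_compat; lra).
  assert (Htaud : tau < d).
  { unfold tau. apply Rmult_lt_reg_r with (INR N); [lra|].
    replace (t / INR N * INR N) with (t / d * d) by (field; lra). nra. }
  set (s := fun j => INR j * tau).
  assert (Hs : forall j, 0 <= s j)
    by (intros j; apply Rmult_le_pos; [apply pos_INR|lra]).
  (* Chosen after [tau]: two vertex errors give at most [e * tau / 4], the error on [app G] at most
     [tau * e / 4], and the increment of the orbit takes the remaining [e / 2 * tau]. *)
  set (eta := Rmin (e / 4) (e * tau / 8)).
  assert (Heta : 0 < eta) by (apply Rmin_glb_lt; nra).
  pose proof (Rmin_l (e / 4) (e * tau / 8)) as Heta1; fold eta in Heta1.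
  pose proof (Rmin_r (e / 4) (e * tau / 8)) as Heta2; fold eta in Heta2.
  assert (Hz : forall j, exists z, dom G z /\ vnorm (vsub z (U (s j) x)) < eta /\
    vnorm (vsub (app G z) (U (s j) (app C x))) < eta).
  { intros j. destruct (dom_sg HU x (s j) Hx (Hs j)) as [D E].
    apply (HC (U (s j) x) (U (s j) (app C x))); auto. }
  set (z := fun j => proj1_sig (constructive_indefinite_description _ (Hz j))).
  assert (Hz' : forall j, dom G (z j) /\ vnorm (vsub (z j) (U (s j) x)) < eta /\
    vnorm (vsub (app G (z j)) (U (s j) (app C x))) < eta)
    by (intros j; apply (proj2_sig (constructive_indefinite_description _ (Hz j)))).
  clearbody z.
  exists N, z. split; [auto|]. split; [intros j; apply Hz'|]. split; [|split].
  - destruct (Hz' 0%nat) as [_ [H1 _]]. unfold s in H1. simpl INR in H1.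
    rewrite Rmult_0_l, (sg_0 HU), vnorm_sub_sym in H1. lra.
  - destruct (Hz' N) as [_ [H1 _]]. unfold s, tau in H1.
    replace (INR N * (t / INR N)) with t in H1 by (field; lra). lra.
  - intros j Hj tau'. change tau' with tau. clear tau'.
    assert (Hj1 : s (S j) = s j + tau) by (unfold s; rewrite S_INR; ring).
    assert (Hsj : s (S j) <= t).
    { unfold s, tau. replace t with (INR N * (t / INR N)) at 2 by (field; lra).
      apply Rmult_le_compat_r; [apply Rlt_le, Htau|apply le_INR; lia]. }
    (* Both endpoints are treated at once: [C] along the orbit varies by less than [e / 2] on a grid
       interval, since [tau < d]. *)
    assert (key : forall i, i = j \/ i = S j ->
      vnorm (vsub (vsub (z (S j)) (z j)) (vscal tau (app G (z i)))) <= e * tau).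
    { intros i Hi.
      assert (Hsi : s j <= s i <= s j + tau) by (destruct Hi; subst i; lra).
      destruct (dom_sg HU x (s j) Hx (Hs j)) as [D E].
      assert (Hincr : vnorm (vsub (vsub (U tau (U (s j) x)) (U (s j) x))
        (vscal tau (U (s i) (app C x)))) <= e / 2 * tau).
      { apply (sg_increment HU); [auto|lra|]. intros r Hr.
        rewrite E, <- (sg_add HU) by (try lra; apply Hs).
        apply Rlt_le, Hunif.
        - split; [apply Hs|lra].
        - pose proof (Hs j); lra.
        - apply Rabs_lt_between'. lra. }
      rewrite <- (sg_add HU) in Hincr by (try lra; apply Hs).
      replace (tau + s j) with (s (S j)) in Hincr by lra.
      destruct (Hz' j) as [_ [H1 _]], (Hz' (S j)) as [_ [H2 _]], (Hz' i) as [_ [_ H3]].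
      replace (vsub (vsub (z (S j)) (z j)) (vscal tau (app G (z i)))) with
        (vadd (vadd (vadd (vsub (z (S j)) (U (s (S j)) x)) (vopp (vsub (z j) (U (s j) x))))
          (vscal tau (vopp (vsub (app G (z i)) (U (s i) (app C x))))))
          (vsub (vsub (U (s (S j)) x) (U (s j) x)) (vscal tau (U (s i) (app C x))))) by vec.
      eapply Rle_trans; [apply vnorm_triangle|].
      eapply Rle_trans; [apply Rplus_le_compat; [|exact Hincr]|].
      - eapply vnorm_le3; [reflexivity|apply Rlt_le, H2|rewrite vnorm_opp; apply Rlt_le, H1|].
        rewrite vnorm_scal_pos, vnorm_opp by lra.
        apply Rmult_le_compat_l; [lra|apply Rlt_le, H3].
      - nra. }
    split; apply key; auto.
Qed.

(** * Convergence *)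

Definition eventually2 (Q : nat -> nat -> Prop) : Prop :=
  exists N, forall n m, (N <= n)%nat -> (N <= m)%nat -> Q n m.

Lemma eventually2_and Q Q' :
  eventually2 Q -> eventually2 Q' -> eventually2 (fun n m => Q n m /\ Q' n m).
Proof.
  intros [N H] [N' H']. exists (Nat.max N N'). intros n m Hn Hm.
  split; [apply H|apply H']; lia.
Qed.

Lemma eventually2_forall_le (Q : nat -> nat -> nat -> Prop) k :
  (forall j, eventually2 (Q j)) -> eventually2 (fun n m => forall j, (j <= k)%nat -> Q j n m).
Proof.
  intros H; induction k as [|k IH].
  - destruct (H 0%nat) as [N HN]. exists N. intros n m Hn Hm j Hj.
    replace j with 0%nat by lia. auto.
  - destruct (eventually2_and _ _ IH (H (S k))) as [N HN]. exists N. intros n m Hn Hm j Hj.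
    destruct (HN n m Hn Hm) as [H1 H2].
    destruct (Nat.eq_dec j (S k)) as [->|Hne]; [auto|apply H1; lia].
Qed.

Lemma eventually2_small a b : 0 < b -> eventually2 (fun n _ => a / INR n <= b).
Proof.
  intros Hb. destruct (INR_unbounded (Rmax 0 (a / b))) as [N HN].
  exists N. intros n m Hn _. apply le_INR in Hn.
  pose proof (Rmax_l 0 (a / b)); pose proof (Rmax_r 0 (a / b)).
  apply Rmult_le_reg_r with (INR n); [lra|].
  replace (a / INR n * INR n) with (a / b * b) by (field; lra). nra.
Qed.

Lemma eventually2_div k a : (1 <= k)%nat -> eventually2 (fun n _ => a <= INR (n / k)).
Proof.
  intros Hk. destruct (INR_unbounded a) as [N HN]. exists (k * N)%nat. intros n m Hn _.
  apply Rle_trans with (INR N); [lra|]. apply le_INR, Nat.div_le_lower_bound; lia.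
Qed.

(** The splitting enters only through a one-step family [K], stable in its powers up to [n] and
    consistent on [dom G], so the argument is carried out for any such [K]. *)
Theorem chernoff_approximation (X : Banach) (G C : Op X) (U : R -> X -> X)
  (Xm : nat -> Banach) (P : forall m, X -> Xm m) (J : forall m, Xm m -> X)
  (K : forall m, R -> Xm m -> Xm m) (cP cJ c t : R) :
  is_closure G C -> generates C U ->
  0 < cP -> (forall m, linear_map (P m)) -> (forall m, opnorm_le (P m) cP) ->
  0 < cJ -> (forall m, linear_map (J m)) -> (forall m, opnorm_le (J m) cJ) ->
  (forall x, seq_lim (fun m => J m (P m x)) x) ->
  (forall m h, 0 <= h -> linear_map (K m h)) ->
  0 < t -> 0 < c ->
  (forall k n m, (k <= n)%nat -> (1 <= n)%nat -> opnorm_le (Nat.iter k (K m (t / INR n))) c) ->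
  (forall z e, dom G z -> 0 < e -> exists h0 m0, 0 < h0 /\
    forall m h, (m0 <= m)%nat -> 0 <= h <= h0 ->
      vnorm (vsub (vsub (K m h (P m z)) (P m z)) (vscal h (P m (app G z)))) <= e * h) ->
  forall x eps, 0 < eps -> eventually2 (fun n m =>
    vnorm (vsub (J m (Nat.iter n (K m (t / INR n)) (P m x))) (U t x)) <= eps).
Proof.
  intros HC HU HcP HP HPb HcJ HJ HJb HJP HK Ht Hc Hstab Hcons x eps Heps.
  destruct (bounded_linear_opnorm _ _ _ (proj1 (proj1 HU) t (Rlt_le _ _ Ht)))
    as [cU [HcU HUb]].
  (* The sum of the constants in the final estimate, which is then exactly [bd * e]. *)
  set (bd := cJ * (2 * (c * cP) + (c * (c * (c * (1 + 2 * cP) * t)) + 1)) + 2 + cU).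
  assert (Hbd : 0 < bd).
  { unfold bd. assert (0 < c * cP) by nra. assert (0 < c * (1 + 2 * cP) * t).
    { apply Rmult_lt_0_compat; nra. }
    assert (0 < c * (c * (c * (1 + 2 * cP) * t))) by (repeat apply Rmult_lt_0_compat; nra).
    assert (0 < cJ * (2 * (c * cP) + (c * (c * (c * (1 + 2 * cP) * t)) + 1)))
      by (apply Rmult_lt_0_compat; lra). lra. }
  set (e := eps / bd). assert (He : 0 < e) by now apply Rdiv_lt_0_compat.
  assert (Heps' : eps = bd * e) by (unfold e; field; lra). clearbody e.
  destruct (generator_dense X C U HU x e He) as [y [Hy Hxy]].
  destruct (approximate_trajectory X G C U y t e HC HU Hy Ht He)
    as [N [z [HN [Hz [Hz0 [HzN Hztau]]]]]].
  set (tau := t / INR N) in *.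
  assert (HN0 : 1 <= INR N) by (apply (le_INR 1); auto).
  assert (Htau : 0 < tau) by (apply Rdiv_lt_0_compat; lra).
  assert (Ev1 : eventually2 (fun n m => forall j, (j <= N)%nat -> let h := t / INR n in
    vnorm (vsub (vsub (K m h (P m (z j))) (P m (z j))) (vscal h (P m (app G (z j)))))
      <= e * h)).
  { apply (eventually2_forall_le (fun j n m => let h := t / INR n in
      vnorm (vsub (vsub (K m h (P m (z j))) (P m (z j))) (vscal h (P m (app G (z j)))))
        <= e * h)).
    intros j. destruct (Hcons (z j) e (Hz j) He) as [h0 [m0 [Hh0 H]]].
    destruct (eventually2_small t h0 Hh0) as [N1 HN1].
    exists (Nat.max 1 (Nat.max N1 m0)). intros n m Hn Hm h. apply H; [lia|]. split.
    - apply Rlt_le, Rdiv_lt_0_compat; auto. apply lt_0_INR; lia.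
    - apply (HN1 n n); lia. }
  (* This size of [n / N] keeps the mismatch between [h / tau] and [1 / q] along each edge below
     [e * h]. *)
  assert (Ev2 : eventually2 (fun n _ => forall j, (j <= N)%nat ->
    INR N * vnorm (vsub (z (S j)) (z j)) / (e * t) <= INR (n / N))).
  { apply (eventually2_forall_le (fun j n _ =>
      INR N * vnorm (vsub (z (S j)) (z j)) / (e * t) <= INR (n / N))).
    intros j. now apply eventually2_div. }
  (* Fewer than [N] steps remain after the last full edge, each moving [P m (z N)] by an amount
     proportional to [h]. *)
  assert (Ev3 : eventually2 (fun n _ =>
    INR N * (c * (t * (e + cP * vnorm (app G (z N))))) / INR n <= e))
    by now apply eventually2_small.
  assert (Ev4 : eventually2 (fun _ m => vnorm (vsub (J m (P m (z N))) (z N)) <= e)).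
  { destruct (HJP (z N) e He) as [m0 H]. exists m0. intros n m _ Hm. now apply Rlt_le, H. }
  destruct (eventually2_and _ _ (eventually2_and _ _ Ev1 Ev2) (eventually2_and _ _ Ev3 Ev4))
    as [N0 HN0'].
  exists (Nat.max N N0). intros n m Hn Hm.
  destruct (HN0' n m ltac:(lia) ltac:(lia)) as [[Hcon Hgap] [Hrem HJm]].
  clear Ev1 Ev2 Ev3 Ev4 HN0'.
  assert (Hn0 : 1 <= INR n) by (apply (le_INR 1); lia).
  set (h := t / INR n) in *. cbv zeta in Hcon.
  assert (Hh : 0 < h) by (apply Rdiv_lt_0_compat; lra).
  set (q := (n / N)%nat) in *. set (r := (n mod N)%nat).
  assert (Hqr : n = (N * q + r)%nat) by (apply Nat.div_mod; lia).
  assert (Hr : (r < N)%nat) by (apply Nat.mod_upper_bound; lia).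
  assert (Hq : (1 <= q)%nat) by (apply Nat.div_le_lower_bound; lia).
  clearbody q r.
  assert (Hq0 : 1 <= INR q) by (apply (le_INR 1); auto).
  assert (HqrR : INR n = INR N * INR q + INR r) by (rewrite Hqr, plus_INR, mult_INR; auto).
  assert (HrR : 0 <= INR r <= INR N) by (split; [apply pos_INR|apply le_INR; lia]).
  set (k := K m h).
  assert (Hk : linear_map k) by (apply HK; lra).
  assert (Hkb : forall i, (i <= n)%nat -> opnorm_le (Nat.iter i k) c)
    by (intros i Hi; apply Hstab; lia).
  assert (block : forall j, (j < N)%nat ->
    vnorm (vsub (Nat.iter q k (P m (z j))) (P m (z (S j))))
      <= INR q * (c * ((1 + 2 * cP) * (e * h)))).
  { intros j Hj. destruct (Hztau j Hj) as [Hg Hg'].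
    apply (segment_error X (Xm m) (P m) k (z j) (z (S j)) (app G (z j)) (app G (z (S j)))
      q c cP h tau e); auto; try lra; try (apply Hcon; lia).
    - intros i Hi. apply Hkb. nia.
    - specialize (Hgap j ltac:(lia)). set (D := vnorm (vsub (z (S j)) (z j))) in *.
      assert (HD : 0 <= D) by apply vnorm_nonneg.
      (* Here [h / tau = N / n] and [n = N q + r], so integer division is the only source of the
         mismatch. *)
      replace (h / tau - / INR q) with (- (INR r / (INR n * INR q))).
      2: { unfold h, tau. rewrite HqrR. field. repeat split; nra. }
      rewrite Rabs_Ropp, Rabs_pos_eq.
      2: { apply Rmult_le_pos; [lra|]. apply Rlt_le, Rinv_0_lt_compat; nra. }
      apply Rle_trans with (INR N * D / (e * t) * (e * h / INR q)).
      + replace (INR N * D / (e * t) * (e * h / INR q)) with (INR N / (INR n * INR q) * D)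
          by (unfold h; field; repeat split; lra).
        apply Rmult_le_compat_r; auto. apply Rmult_le_compat_r; [|lra].
        apply Rlt_le, Rinv_0_lt_compat; nra.
      + replace (e * h) with (INR q * (e * h / INR q)) at 2 by (field; lra).
        apply Rmult_le_compat_r; auto.
        apply Rlt_le, Rdiv_lt_0_compat; nra. }
  assert (main : vnorm (vsub (Nat.iter (N * q) k (P m (z 0%nat))) (P m (z N)))
    <= c * (c * (1 + 2 * cP) * t) * e).
  { rewrite iter_mul.
    eapply Rle_trans; [apply (lax_telescope _ (Nat.iter q k) c
      (INR q * (c * ((1 + 2 * cP) * (e * h)))) N (fun j => P m (z j)))|].
    - now apply linear_map_iter.
    - intros i Hi y'. rewrite <- iter_mul. apply Hkb. apply Nat.le_trans with (N * q)%nat; [apply Nat.mul_le_mono_r|]; lia.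
    - exact block.
    - lra.
    - replace (INR N * (c * (INR q * (c * ((1 + 2 * cP) * (e * h))))))
        with (c * (c * (1 + 2 * cP)) * e * (INR N * INR q * h)) by ring.
      replace (c * (c * (1 + 2 * cP) * t) * e) with (c * (c * (1 + 2 * cP)) * e * t) by ring.
      apply Rmult_le_compat_l; [repeat apply Rmult_le_pos; lra|].
      replace t with (INR n * h) by (unfold h; field; lra).
      apply Rmult_le_compat_r; lra. }
  assert (rest : vnorm (vsub (Nat.iter r k (P m (z N))) (P m (z N))) <= e).
  { set (b := e * h + h * (cP * vnorm (app G (z N)))).
    apply Rle_trans with (INR r * (c * b)).
    (* Telescoping along a constant sequence bounds how far [r] steps move a fixed vector. *)
    - apply (lax_telescope _ k c b r (fun _ => P m (z N))); auto; try lra.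
      + intros i Hi; apply Hkb; lia.
      + intros i Hi. unfold b.
        eapply vnorm_le2 with (b := vscal h (P m (app G (z N))));
          [|apply (Hcon N (le_n N))|].
        * fold k. vec.
        * rewrite vnorm_scal_pos by lra. apply Rmult_le_compat_l; [lra|apply HPb].
    - apply Rle_trans with (INR N * (c * b)).
      + apply Rmult_le_compat_r; [|lra]. apply Rmult_le_pos; [lra|].
        assert (0 <= cP * vnorm (app G (z N)))
          by (apply Rmult_le_pos; [lra|apply vnorm_nonneg]).
        unfold b. nra.
      + eapply Rle_trans; [|exact Hrem]. right. unfold b, h. field. lra. }
  assert (Hxz : vnorm (P m (vsub x (z 0%nat))) <= cP * (2 * e)).
  { eapply Rle_trans; [apply HPb|]. apply Rmult_le_compat_l; [lra|].
    replace (2 * e) with (e + e) by ring.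
    eapply vnorm_le2; [|apply Rlt_le, Hxy|exact Hz0]. vec. }
  assert (Hdisc : vnorm (vsub (Nat.iter n k (P m x)) (P m (z N)))
    <= c * (cP * (2 * e)) + c * (c * (c * (1 + 2 * cP) * t) * e) + e).
  { eapply vnorm_le3 with (a := Nat.iter n k (P m (vsub x (z 0%nat))))
      (b := Nat.iter r k (vsub (Nat.iter (N * q) k (P m (z 0%nat))) (P m (z N))));
      [| | |exact rest].
    - rewrite (linear_map_sub (HP m)), !(linear_map_sub (linear_map_iter _ _ _ Hk)).
      rewrite <- Nat.iter_add. replace (r + N * q)%nat with n by lia. vec.
    - eapply Rle_trans; [apply Hkb; lia|]. apply Rmult_le_compat_l; lra.
    - eapply Rle_trans; [apply Hkb; lia|]. apply Rmult_le_compat_l; lra. }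
  assert (HUxy : vnorm (U t (vsub y x)) <= cU * e).
  { eapply Rle_trans; [apply HUb|]. rewrite vnorm_sub_sym. apply Rmult_le_compat_l; lra. }
  rewrite (linear_map_sub (sg_linear HU t (Rlt_le _ _ Ht))) in HUxy.
  apply Rle_trans with (cJ * (c * (cP * (2 * e)) + c * (c * (c * (1 + 2 * cP) * t) * e) + e)
    + (e + e) + cU * e).
  - eapply vnorm_le3 with (a := J m (vsub (Nat.iter n k (P m x)) (P m (z N))));
      [| | |exact HUxy].
    + rewrite (linear_map_sub (HJ m)).
      instantiate (1 := vadd (vsub (J m (P m (z N))) (z N)) (vsub (z N) (U t y))). vec.
    + eapply Rle_trans; [apply HJb|]. apply Rmult_le_compat_l; lra.
    + now apply (vnorm_le2 _ _ _ _ _ _ eq_refl).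
  - right. rewrite Heps'. unfold bd. ring.
Qed.

(** * Application to the sequential splitting *)

Lemma exp_nondecreasing a b : a <= b -> exp a <= exp b.
Proof. intros [H| ->]; [apply Rlt_le, exp_increasing, H|apply Rle_refl]. Qed.

Lemma exp_le_abs a h : 0 <= h <= 1 -> exp (a * h) <= exp (Rabs a).
Proof.
  intros Hh. apply exp_nondecreasing.
  pose proof (Rle_abs a); pose proof (Rabs_pos a). nra.
Qed.

(** The growth bound is given for positive times only; at [0] the semigroup is the identity and
    [1 <= M] suffices. *)
Lemma sg_bound_unit_interval (X : Banach) (A : Op X) (T : R -> X -> X) M w :
  generates A T -> 1 <= M -> (forall h, 0 < h -> opnorm_le (T h) (M * exp (w * h))) ->
  forall s, 0 <= s <= 1 -> opnorm_le (T s) (M * exp (Rabs w)).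
Proof.
  intros HT HM Hb s Hs. destruct (Req_dec s 0) as [->|Hn].
  - intros x. rewrite (sg_0 HT). pose proof (vnorm_nonneg X x).
    assert (1 <= exp (Rabs w)).
    { rewrite <- exp_0. apply exp_nondecreasing, Rabs_pos. }
    assert (1 <= M * exp (Rabs w)) by nra. nra.
  - eapply opnorm_le_weaken; [apply Hb; lra|].
    apply Rmult_le_compat_l; [lra|now apply exp_le_abs].
Qed.

Theorem mainTheorem5
  (* standing setting *)
  (X : Banach) (A B C : Op X) (T S U : R -> X -> X)
  (hAlin : linear_op A) (hAcl : closed_op A) (hAdense : densely_defined A)
  (hBlin : linear_op B) (hBcl : closed_op B) (hBdense : densely_defined B)
  (hT : generates A T) (hS : generates B S)
  (hC : is_closure (op_sum A B) C)
  (hCdom : forall x, dom A x -> dom B x -> dom C x)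
  (hU : generates C U)
  (* approximation setting *)
  (Xm : nat -> Banach)
  (P : forall m, X -> Xm m) (J : forall m, Xm m -> X)
  (MJ MP : R)
  (hP : forall m, bounded_linear (P m)) (hJ : forall m, bounded_linear (J m))
  (hPJ : forall m (y : Xm m), P m (J m y) = y)
  (hJP : forall x, seq_lim (fun m => J m (P m x)) x)
  (hJb : forall m, opnorm_le (J m) MJ) (hPb : forall m, opnorm_le (P m) MP)
  (Am Bm : forall m, Op (Xm m))
  (Tm Sm : forall m, R -> Xm m -> Xm m)
  (hTm : forall m, generates (Am m) (Tm m))
  (hSm : forall m, generates (Bm m) (Sm m))
  (* stability *)
  (MT wT MS wS M w : R)
  (hMT : 1 <= MT) (hMS : 1 <= MS) (hM : 1 <= M)
  (hS1 : forall h, 0 < h -> opnorm_le (T h) (MT * exp (wT * h)) /\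
            forall m, opnorm_le (Tm m h) (MT * exp (wT * h)))
  (hS2 : forall h, 0 < h -> opnorm_le (S h) (MS * exp (wS * h)) /\
            forall m, opnorm_le (Sm m h) (MS * exp (wS * h)))
  (hSseq : forall t k n m, 0 <= t -> (1 <= n)%nat ->
      opnorm_le (Nat.iter k (fun y => Sm m (t / INR n) (Tm m (t / INR n) y)))
                (M * exp (INR k * w * t / INR n)))
  (* consistency *)
  (hC1 : forall x, dom A x -> (forall m, dom (Am m) (P m x)) /\
            seq_lim (fun m => J m (app (Am m) (P m x))) (app A x))
  (hC2 : forall x, dom B x -> (forall m, dom (Bm m) (P m x)) /\
            seq_lim (fun m => J m (app (Bm m) (P m x))) (app B x)) :
  forall t, 0 < t -> forall (x : X) eps, 0 < eps ->
    exists N : nat, forall n m, (N <= n)%nat -> (N <= m)%nat ->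
      vnorm (vsub (J m (Nat.iter n (fun y => Sm m (t / INR n) (Tm m (t / INR n) y)) (P m x)))
                  (U t x)) <= eps.
Proof.
  intros t Ht.
  (* The maxima with [1] make the bounds positive. For [k <= n] the exponent [k w t / n] is at most
     [Rabs w * t], whence the stability constant. *)
  apply (chernoff_approximation X (op_sum A B) C U Xm P J
    (fun m h y => Sm m h (Tm m h y)) (Rmax MP 1) (Rmax MJ 1) (M * exp (Rabs w * t))); auto.
  - pose proof (Rmax_r MP 1); lra.
  - intros m; apply hP.
  - intros m; eapply opnorm_le_weaken; [apply hPb|apply Rmax_l].
  - pose proof (Rmax_r MJ 1); lra.
  - intros m; apply hJ.
  - intros m; eapply opnorm_le_weaken; [apply hJb|apply Rmax_l].
  - intros m h Hh.
    assert (L1 := sg_linear (hTm m) h Hh). assert (L2 := sg_linear (hSm m) h Hh).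
    split; intros; [rewrite (proj1 L1); apply L2|rewrite (proj2 L1); apply L2].
  - apply Rmult_lt_0_compat; [lra|apply exp_pos].
  - intros k n m Hkn Hn. eapply opnorm_le_weaken; [apply hSseq; lra || auto|].
    apply Rmult_le_compat_l; [lra|]. apply exp_nondecreasing.
    apply le_INR in Hkn. assert (1 <= INR n) by (apply (le_INR 1); auto).
    pose proof (pos_INR k). pose proof (Rle_abs w). pose proof (Rabs_pos w).
    replace (INR k * w * t / INR n) with (w * (t * (INR k / INR n))) by (field; lra).
    assert (0 <= INR k / INR n <= 1).
    { split; [apply Rmult_le_pos; [lra|apply Rlt_le, Rinv_0_lt_compat; lra]|].
      apply Rmult_le_reg_r with (INR n); [lra|]. field_simplify; lra. }
    apply Rle_trans with (Rabs w * (t * (INR k / INR n))).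
    + apply Rmult_le_compat_r; nra.
    + apply Rmult_le_compat_l; nra.
  - intros z e [HzA HzB] He.
    set (cP := Rmax MP 1) in *.
    assert (HcP : 0 < cP) by (pose proof (Rmax_r MP 1); unfold cP; lra).
    assert (HP : forall m, linear_map (P m)) by (intros m; apply hP).
    assert (HPb : forall m, opnorm_le (P m) cP)
      by (intros m; eapply opnorm_le_weaken; [apply hPb|apply Rmax_l]).
    set (cT := MT * exp (Rabs wT)). set (cS := MS * exp (Rabs wS)).
    assert (HcT : 0 < cT) by (apply Rmult_lt_0_compat; [lra|apply exp_pos]).
    assert (HcS : 0 < cS) by (apply Rmult_lt_0_compat; [lra|apply exp_pos]).
    assert (HTb : forall m s, 0 <= s <= 1 -> opnorm_le (Tm m s) cT).
    { intros m. apply (sg_bound_unit_interval _ _ _ _ _ (hTm m)); auto.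
      intros h Hh; now apply hS1. }
    assert (HSb : forall m s, 0 <= s <= 1 -> opnorm_le (Sm m s) cS).
    { intros m. apply (sg_bound_unit_interval _ _ _ _ _ (hSm m)); auto.
      intros h Hh; now apply hS2. }
    (* The three local errors below weigh [cS], [1] and [1]. *)
    set (e' := e / (cS + 2)).
    assert (He' : 0 < e') by (apply Rdiv_lt_0_compat; lra).
    destruct (sg_consistency HcP HP HPb hPJ hAdense hTm HcT HTb hC1 z e' HzA He')
      as [h1 [m1 [Hh1 H1]]].
    destruct (sg_equicontinuous HcP HP HPb hPJ hBdense hSm HcS HSb hC2 (app A z) e' He')
      as [h2 [m2 [Hh2 H2]]].
    destruct (sg_consistency HcP HP HPb hPJ hBdense hSm HcS HSb hC2 z e' HzB He')
      as [h3 [m3 [Hh3 H3]]].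
    exists (Rmin h1 (Rmin h2 h3)), (Nat.max m1 (Nat.max m2 m3)).
    split; [repeat apply Rmin_glb_lt; lra|].
    intros m h Hm Hh.
    pose proof (Rmin_l h1 (Rmin h2 h3)); pose proof (Rmin_r h1 (Rmin h2 h3)).
    pose proof (Rmin_l h2 h3); pose proof (Rmin_r h2 h3).
    specialize (H1 m h ltac:(lia) ltac:(lra)). specialize (H2 m h ltac:(lia) ltac:(lra)).
    specialize (H3 m h ltac:(lia) ltac:(lra)).
    replace (e * h) with (cS * (e' * h) + h * e' + e' * h) by (unfold e'; field; lra).
    (* The error of the product splits into [Sm] applied to the error of [Tm], [h] times the
       displacement of [P m (app A z)] by [Sm], and the error of [Sm] at [z]. *)
    eapply vnorm_le3 with
      (a := Sm m h (vsub (vsub (Tm m h (P m z)) (P m z)) (vscal h (P m (app A z)))))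
      (b := vscal h (vsub (Sm m h (P m (app A z))) (P m (app A z)))); [| | |exact H3].
    + assert (L := sg_linear (hSm m) h (proj1 Hh)).
      simpl. rewrite !(linear_map_sub L), (proj2 L), (proj1 (HP m)). vec.
    + eapply Rle_trans; [apply HSb; lra|]. apply Rmult_le_compat_l; lra.
    + rewrite vnorm_scal_pos by lra. apply Rmult_le_compat_l; lra.
Qed.
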